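(* Let $\nu>-1$ and $r>0$. Put $\rho_\nu=0$ and $\varrho_\nu=-\frac{r^2}{4(\nu+1)}$. Then for all real $x$ with $|x|<r$, $$\left(\frac{r^2-x^2}{r^2}\right)^{\rho_{\nu}}\leq\mathcal{I}_{\nu}(x)\leq\left(\frac{r^2-x^2}{r^2}\right)^{\varrho_{\nu}}.$$ Moreover the constants are best possible: $\rho_\nu$ is the smallest real number $\rho$ such that $\left(\frac{r^2-x^2}{r^2}\right)^{\rho}\le\mathcal{I}_\nu(x)$ for all $|x|<r$, and $\varrho_\nu$ is the largest real number $\varrho$ such that $\mathcal{I}_\nu(x)\le\left(\frac{r^2-x^2}{r^2}\right)^{\varrho}$ for all $|x|<r$.
   Context: For $\nu>-1$, $I_\nu$ is the modified Bessel function of the first kind, $I_\nu(x)=\sum_{n\ge0}\frac{1}{n!\,\Gamma(\nu+n+1)}\left(\frac{x}{2}\right)^{2n+\nu}$ for $x>0$. The normalized modified Bessel function is $\mathcal{I}_\nu(x)=\sum_{n\ge0}\frac{\Gamma(\nu+1)}{n!\,\Gamma(\nu+n+1)}\left(\frac{x}{2}\right)^{2n}$ for $x\in\mathbb{R}$; thus $\mathcal{I}_\nu(x)=2^\nu\Gamma(\nu+1)x^{-\nu}I_\nu(x)$ for $x>0$ and $\mathcal{I}_\nu(0)=1$. *)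

(* Defs.v *)
From Stdlib Require Import Reals Factorial.
From Coquelicot Require Import Coquelicot.
Open Scope R_scope.

(* Euler's integral; it converges exactly for s > 0.  At s <= 0 the value of
   [RInt_gen] is junk. *)
Definition Gamma (s : R) : R :=
  RInt_gen (fun t : R => Rpower t (s - 1) * exp (- t))
           (at_right 0) (Rbar_locally p_infty).

(* For nu > -1 all the arguments of [Gamma] are positive.  The power is the
   natural-number power, so the n = 0 term at x = 0 is 1. *)
Definition normalized_besselI (nu x : R) : R :=
  Series (fun n : nat =>
    Gamma (nu + 1) / (INR (fact n) * Gamma (nu + INR n + 1))
    * (x / 2) ^ (2 * n)).

Definition is_least (E : R -> Prop) (m : R) : Prop :=
  E m /\ forall y : R, E y -> m <= y.

Definition is_greatest (E : R -> Prop) (m : R) : Prop :=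
  E m /\ forall y : R, E y -> y <= m.

(* Main.v *)
(** Termwise comparison does everything.  From [Gamma (s + 1) = s * Gamma s] the
    n-th coefficient of the series lies between 0 and [/ (n! (nu + 1)^n)], with
    equality above for n = 0 and n = 1; hence, with [a = r^2 / (4 (nu + 1))] and
    [u = x^2 / r^2], the function lies between [1 + a u] and [exp (a u)].  Since
    [u <= - ln (1 - u)], [exp (a u)] is at most [(1 - u)^(-a)].  Letting u tend
    to 1 in [(1 - u)^rho <= exp (a u)] forces [rho >= 0], and letting u tend to 0
    in [1 + a u <= (1 - u)^varrho] forces [varrho <= - a].

    The Gamma integral converges because its integrand is dominated by a multiple
    of the derivative of the bounded function [- / (1 + t^s)]. *)

Require Import Defs.
From Stdlib Require Import Reals Factorial Lra.
From Coquelicot Require Import Coquelicot.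
Open Scope R_scope.

(** * Elementary facts on exp, ln and real powers *)

Lemma ln_le_sub_1 (x : R) : 0 < x -> ln x <= x - 1.
Proof.
  intros Hx.
  pose proof (exp_ineq1_le (ln x)) as H.
  rewrite exp_ln in H; lra.
Qed.

Lemma exp_monotone (x y : R) : x <= y -> exp x <= exp y.
Proof.
  intros [H | ->]; [left; now apply exp_increasing | right; reflexivity].
Qed.

Lemma Rpower_sub_1 (t s : R) : 0 < t -> Rpower t (s - 1) = Rpower t s / t.
Proof.
  intros Ht. unfold Rminus, Rdiv.
  rewrite Rpower_plus, Rpower_Ropp, Rpower_1; trivial.
Qed.

(** * Improper integrals over the positive half-line *)

Lemma ex_RInt_pos (f : R -> R) (a b : R) :
  (forall t, 0 < t -> continuous f t) -> 0 < a -> 0 < b -> ex_RInt f a b.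
Proof.
  intros Hf Ha Hb.
  apply (ex_RInt_continuous (V := R_CompleteNormedModule)).
  intros t [Ht _]. apply Hf.
  apply Rlt_le_trans with (2 := Ht). now apply Rmin_glb_lt.
Qed.

(** Turns a claim about endpoints tending to 0 from the right and to infinity into one with explicit
    bounds on them. *)
Lemma filter_prod_pos (P : R * R -> Prop) (a b : R) :
  0 < a ->
  (forall x y, 0 < x < a -> b < y -> P (x, y)) ->
  filter_prod (at_right 0) (Rbar_locally p_infty) P.
Proof.
  intros Ha H.
  exists (fun x => 0 < x < a) (fun y => b < y).
  - exists (mkposreal a Ha). intros x Hx H0. split; [exact H0 |].
    change (Rabs (x - 0) < a) in Hx.
    rewrite Rminus_0_r in Hx. apply Rle_lt_trans with (2 := Hx). apply Rle_abs.
  - now exists b.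
  - exact H.
Qed.

(** Fundamental theorem of calculus on the open half-line. [Derive F] is known to agree with [f]
    only at positive points, so continuity is transferred through the ball of radius t around t. *)
Lemma is_RInt_gen_pos_antiderivative (F f : R -> R) (la lb : R) :
  (forall t, 0 < t -> is_derive F t (f t)) ->
  (forall t, 0 < t -> continuous f t) ->
  filterlim F (at_right 0) (locally la) ->
  filterlim F (Rbar_locally p_infty) (locally lb) ->
  is_RInt_gen f (at_right 0) (Rbar_locally p_infty) (lb - la).
Proof.
  intros HF Hf Ha Hb.
  apply (is_RInt_gen_ext (Derive F)).
  { apply (filter_prod_pos _ 1 1); [lra |].
    intros x y Hx Hy t [Ht _]. simpl in Ht.
    apply is_derive_unique, HF.
    apply Rlt_trans with (2 := Ht). apply Rmin_glb_lt; lra. }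
  apply is_RInt_gen_Derive; trivial; apply (filter_prod_pos _ 1 1); try lra;
    intros x y Hx Hy t [Ht _]; simpl in Ht;
    assert (H0 : 0 < t)
      by (apply Rlt_le_trans with (2 := Ht); apply Rmin_glb_lt; lra).
  - exists (f t). now apply HF.
  - apply (continuous_ext_loc _ f).
    + exists (mkposreal t H0). intros z Hz. symmetry.
      apply is_derive_unique, HF.
      change (Rabs (z - t) < t) in Hz. apply Rabs_def2 in Hz. lra.
    + now apply Hf.
Qed.

(** The integral of a nonnegative function grows with the interval, so the supremum over all [a, b]
    is the limit. The second conclusion later yields positivity of [Gamma]. *)
Lemma is_RInt_gen_pos_bounded (f : R -> R) (M : R) :
  (forall t, 0 < t -> continuous f t) ->
  (forall t, 0 < t -> 0 <= f t) ->
  (forall a b, 0 < a <= b -> RInt f a b <= M) ->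
  exists L, is_RInt_gen f (at_right 0) (Rbar_locally p_infty) L /\
    forall a b, 0 < a <= b -> RInt f a b <= L.
Proof.
  intros Hc H0 HM.
  destruct (completeness (fun v => exists a b, 0 < a <= b /\ v = RInt f a b))
    as [L [HL1 HL2]].
  - exists M. intros v (a & b & Hab & ->). now apply HM.
  - exists (RInt f 1 1), 1, 1. split; [lra | reflexivity].
  - exists L.
    assert (HL : forall a b, 0 < a <= b -> RInt f a b <= L)
      by (intros a b Hab; apply HL1; now exists a, b).
    split; [| exact HL].
    intros P [eps HP].
    assert (exists a b, 0 < a <= b /\ L - eps < RInt f a b) as (a & b & Hab & Hlt).
    { apply Classical_Prop.NNPP. intros Hn.
      assert (L <= L - eps).
      { apply HL2. intros v (a & b & Hab & ->).
        apply Rnot_lt_le. intros Hlt. apply Hn. now exists a, b. }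
      pose proof (cond_pos eps). lra. }
    apply (filter_prod_pos _ a b); [lra |].
    intros x y Hx Hy. exists (RInt f x y). split.
    + apply (RInt_correct (V := R_CompleteNormedModule)), ex_RInt_pos; trivial; lra.
    + apply HP. change (Rabs (RInt f x y - L) < eps).
      (* The two outer pieces are nonnegative, so the integral over [x, y] also lies above L -
         eps. *)
      assert (E : RInt f x y = RInt f x a + (RInt f a b + RInt f b y)).
      { pose proof (RInt_Chasles f a b y) as E1.
        pose proof (RInt_Chasles f x a y) as E2.
        unfold plus in E1, E2; simpl in E1, E2.
        rewrite E1, E2; trivial; apply ex_RInt_pos; trivial; lra. }
      assert (0 <= RInt f x a)
        by (apply RInt_ge_0; [lra | apply ex_RInt_pos; trivial; lra |];
            intros; apply H0; lra).
      assert (0 <= RInt f b y)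
        by (apply RInt_ge_0; [lra | apply ex_RInt_pos; trivial; lra |];
            intros; apply H0; lra).
      assert (RInt f x y <= L) by (apply HL; lra).
      apply Rabs_def1; lra.
Qed.

(** * The Gamma function *)

Lemma continuous_Gamma_integrand (s t : R) :
  0 < t -> continuous (fun t => Rpower t (s - 1) * exp (- t)) t.
Proof.
  intros Ht. apply (ex_derive_continuous (V := R_NormedModule)).
  unfold Rpower. auto_derive. lra.
Qed.

(** Apply ln y <= y - 1 at y = t / (2 s) and multiply by s; this gives K = (2 s)^s. *)
Lemma Rpower_le_exp_half (s : R) :
  0 < s -> exists K, 0 < K /\ forall t, 0 < t -> Rpower t s <= K * exp (t / 2).
Proof.
  intros Hs. exists (exp (s * ln (2 * s))). split; [apply exp_pos |].
  intros t Ht. unfold Rpower. rewrite <- exp_plus. apply exp_monotone.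
  assert (Hq : 0 < t / (2 * s)) by (apply Rdiv_lt_0_compat; lra).
  pose proof (ln_le_sub_1 _ Hq) as H.
  replace t with (2 * s * (t / (2 * s))) at 1 by (field; lra).
  rewrite ln_mult by lra.
  assert (Hm : s * ln (t / (2 * s)) <= s * (t / (2 * s) - 1))
    by (apply Rmult_le_compat_l; lra).
  replace (s * (t / (2 * s) - 1)) with (t / 2 - s) in Hm by (field; lra).
  lra.
Qed.

Lemma RInt_Gamma_integrand_bounded (s : R) :
  0 < s -> exists M, forall a b, 0 < a <= b ->
    RInt (fun t => Rpower t (s - 1) * exp (- t)) a b <= M.
Proof.
  intros Hs. destruct (Rpower_le_exp_half s Hs) as (K & HK & Hle).
  (* This C makes C s / (1 + t^s)^2 >= exp (-t), because 1 + t^s <= (1 + K) exp (t / 2). *)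
  set (C := (1 + K) ^ 2 / s).
  assert (HC : 0 < C) by (apply Rdiv_lt_0_compat; [nra | lra]).
  exists C. intros a b Hab.
  (* [G] is an antiderivative of the majorant [g], with values in [-C, 0]; its increments are
     therefore at most C. *)
  set (G := fun t => - C / (1 + Rpower t s)).
  set (g := fun t => C * s * Rpower t (s - 1) / (1 + Rpower t s) ^ 2).
  assert (Hpos : forall x y, 0 < Rpower x y) by (intros; apply exp_pos).
  assert (Hg : is_RInt g a b (G b - G a)).
  { apply (is_RInt_derive (V := R_CompleteNormedModule) G g);
      intros t [Ht _]; rewrite Rmin_left in Ht by lra.
    - unfold G, g. rewrite Rpower_sub_1 by lra. unfold Rpower.
      auto_derive.
      + split; [lra |]. split; [| trivial]. pose proof (exp_pos (s * ln t)). lra.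
      + pose proof (exp_pos (s * ln t)). field. lra.
    - apply (ex_derive_continuous (V := R_NormedModule)).
      unfold g, Rpower. auto_derive.
      pose proof (exp_pos (s * ln t)).
      repeat split; trivial; try lra.
      apply Rgt_not_eq. nra. }
  apply Rle_trans with (RInt g a b).
  - apply RInt_le; [lra | | now exists (G b - G a) |].
    + apply ex_RInt_pos; try lra. apply continuous_Gamma_integrand.
    + intros t Ht. unfold g.
      pose proof (Hpos t s). pose proof (Hpos t (s - 1)).
      replace (C * s) with ((1 + K) ^ 2) by (unfold C; field; lra).
      assert (Hq : (1 + Rpower t s) ^ 2 * exp (- t) <= (1 + K) ^ 2).
      { replace (exp (- t)) with (/ exp (t / 2) ^ 2)
          by (rewrite exp_Ropp; f_equal; rewrite <- Rsqr_pow2; unfold Rsqr;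
              rewrite <- exp_plus; f_equal; lra).
        pose proof (exp_ineq1_le (t / 2)).
        assert (1 + Rpower t s <= (1 + K) * exp (t / 2))
          by (specialize (Hle t); nra).
        apply Rmult_le_reg_r with (exp (t / 2) ^ 2); [nra |].
        rewrite Rmult_assoc, Rinv_l, Rmult_1_r by (apply Rgt_not_eq; nra).
        rewrite <- Rpow_mult_distr. apply pow_incr. lra. }
      apply Rmult_le_reg_r with ((1 + Rpower t s) ^ 2); [nra |].
      replace ((1 + K) ^ 2 * Rpower t (s - 1) / (1 + Rpower t s) ^ 2
               * (1 + Rpower t s) ^ 2) with ((1 + K) ^ 2 * Rpower t (s - 1))
        by (field; lra).
      nra.
  - rewrite (is_RInt_unique (V := R_CompleteNormedModule) _ _ _ _ Hg). unfold G.
    assert (Hdiv : forall t, 0 <= C / (1 + Rpower t s) <= C).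
    { intros t. pose proof (Hpos t s). split.
      - apply Rlt_le, Rdiv_lt_0_compat; lra.
      - apply Rle_div_l; nra. }
    pose proof (Hdiv a). pose proof (Hdiv b).
    unfold Rdiv in *. lra.
Qed.

Lemma Gamma_eq (s L : R) :
  is_RInt_gen (fun t => Rpower t (s - 1) * exp (- t))
    (at_right 0) (Rbar_locally p_infty) L ->
  Gamma s = L.
Proof.
  intros H. unfold Gamma.
  apply (is_RInt_gen_unique (Fa := at_right 0) (Fb := Rbar_locally p_infty)
    _ (L : R_CompleteNormedModule) H).
Qed.

Lemma Gamma_correct (s : R) :
  0 < s ->
  is_RInt_gen (fun t => Rpower t (s - 1) * exp (- t))
    (at_right 0) (Rbar_locally p_infty) (Gamma s) /\ 0 < Gamma s.
Proof.
  intros Hs. destruct (RInt_Gamma_integrand_bounded s Hs) as [M HM].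
  assert (Hpos : forall t, 0 < Rpower t (s - 1) * exp (- t))
    by (intros t; apply Rmult_lt_0_compat; apply exp_pos).
  destruct (is_RInt_gen_pos_bounded _ M (continuous_Gamma_integrand s)
    (fun t _ => Rlt_le _ _ (Hpos t)) HM) as [L [HL HLe]].
  rewrite (Gamma_eq s L HL). split; [exact HL |].
  (* Positivity: the integral over [1, 2] is a strictly positive lower bound. *)
  apply Rlt_le_trans with (2 := HLe 1 2 ltac:(lra)).
  apply RInt_gt_0; [lra | trivial |].
  intros t Ht. apply continuous_Gamma_integrand. lra.
Qed.

(** The exponential is at most 1, and t^s < eps once t < eps^(1/s). *)
Lemma Gamma_boundary_0 (s : R) :
  0 < s -> filterlim (fun t => Rpower t s * exp (- t)) (at_right 0) (locally 0).
Proof.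
  intros Hs P [eps HP].
  exists (mkposreal (Rpower eps (/ s)) (exp_pos _)). intros t Ht H0. apply HP.
  change (Rabs (t - 0) < Rpower eps (/ s)) in Ht.
  change (Rabs (Rpower t s * exp (- t) - 0) < eps).
  rewrite Rminus_0_r in *. rewrite Rabs_pos_eq in Ht by lra.
  assert (Hp : 0 < Rpower t s) by apply exp_pos.
  assert (He : exp (- t) <= 1) by (rewrite <- exp_0; apply exp_monotone; lra).
  pose proof (exp_pos (- t)).
  rewrite Rabs_pos_eq by nra.
  apply Rle_lt_trans with (Rpower t s); [nra |].
  replace (pos eps) with (Rpower (Rpower eps (/ s)) s).
  - apply Rlt_Rpower_l; lra.
  - rewrite Rpower_mult, Rinv_l by lra. apply Rpower_1, cond_pos.
Qed.

(** The function is at most K exp (-t / 2), and exp (t / 2) > t / 2 makes this smaller than eps once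
    t > 2 K / eps. *)
Lemma Gamma_boundary_p_infty (s : R) :
  0 < s ->
  filterlim (fun t => Rpower t s * exp (- t)) (Rbar_locally p_infty) (locally 0).
Proof.
  intros Hs. destruct (Rpower_le_exp_half s Hs) as (K & HK & Hle).
  intros P [eps HP]. pose proof (cond_pos eps).
  exists (2 * K / eps). intros t Ht. apply HP.
  change (Rabs (Rpower t s * exp (- t) - 0) < eps).
  assert (Hq : 0 < 2 * K / eps) by (apply Rdiv_lt_0_compat; lra).
  rewrite Rminus_0_r, Rabs_pos_eq
    by (apply Rlt_le, Rmult_lt_0_compat; apply exp_pos).
  apply Rle_lt_trans with (K * exp (- (t / 2))).
  - replace (- (t / 2)) with (t / 2 + - t) by lra.
    rewrite exp_plus, <- Rmult_assoc.
    apply Rmult_le_compat_r; [apply Rlt_le, exp_pos | apply Hle; lra].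
  - rewrite exp_Ropp. pose proof (exp_ineq1_le (t / 2)).
    apply Rlt_div_l; [lra |].
    apply Rlt_div_l in Ht; [| lra].
    nra.
Qed.

(** Integration by parts: t^s exp (-t) has derivative s t^(s-1) exp (-t) - t^s exp (-t) and vanishes
    at both ends. *)
Lemma Gamma_succ (s : R) : 0 < s -> Gamma (s + 1) = s * Gamma s.
Proof.
  intros Hs.
  destruct (Gamma_correct s Hs) as [H _].
  apply (is_RInt_gen_scal _ s) in H.
  assert (Hd : is_RInt_gen
    (fun t => s * (Rpower t (s - 1) * exp (- t)) - Rpower t s * exp (- t))
    (at_right 0) (Rbar_locally p_infty) (0 - 0)).
  { apply (is_RInt_gen_pos_antiderivative (fun t => Rpower t s * exp (- t)));
      [| | now apply Gamma_boundary_0 | now apply Gamma_boundary_p_infty].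
    - intros t Ht. rewrite Rpower_sub_1 by lra. unfold Rpower.
      auto_derive; [lra |]. field. lra.
    - intros t Ht. apply (ex_derive_continuous (V := R_NormedModule)).
      unfold Rpower. auto_derive. lra. }
  pose proof (is_RInt_gen_minus _ _ _ _ H Hd) as Hm.
  apply Gamma_eq.
  unfold minus, plus, opp, scal in Hm; simpl in Hm; unfold mult in Hm; simpl in Hm.
  replace (s * Gamma s + - (0 - 0)) with (s * Gamma s) in Hm by ring.
  revert Hm. apply is_RInt_gen_ext.
  apply (filter_prod_pos _ 1 1); [lra |]. intros x y _ _ t _.
  replace (s + 1 - 1) with s by ring. apply Rminus_diag_uniq. ring.
Qed.

(** * The normalized modified Bessel function *)

(** Each use of the functional equation contributes a factor s + k >= s. *)
Lemma Gamma_add_ge (s : R) (n : nat) :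
  0 < s -> s ^ n * Gamma s <= Gamma (s + INR n).
Proof.
  intros Hs. induction n as [| n IH].
  - simpl. rewrite Rplus_0_r. lra.
  - rewrite S_INR. pose proof (pos_INR n) as Hn.
    replace (s + (INR n + 1)) with (s + INR n + 1) by ring.
    rewrite Gamma_succ by lra. simpl. rewrite Rmult_assoc.
    assert (0 < Gamma s) by now apply Gamma_correct.
    pose proof (pow_lt s n Hs).
    apply Rmult_le_compat; nra.
Qed.

Lemma besselI_coeff_bounds (nu : R) (n : nat) :
  -1 < nu ->
  0 <= Gamma (nu + 1) / (INR (fact n) * Gamma (nu + INR n + 1))
    <= / INR (fact n) * (/ (nu + 1)) ^ n.
Proof.
  intros Hnu. pose proof (pos_INR n). pose proof (INR_fact_lt_0 n) as Hf.
  assert (H1 : 0 < Gamma (nu + 1)) by (apply Gamma_correct; lra).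
  assert (H2 : 0 < Gamma (nu + INR n + 1)) by (apply Gamma_correct; lra).
  split.
  - apply Rlt_le, Rdiv_lt_0_compat; nra.
  - pose proof (Gamma_add_ge (nu + 1) n ltac:(lra)) as H3.
    replace (nu + 1 + INR n) with (nu + INR n + 1) in H3 by ring.
    assert (Hp : 0 < (nu + 1) ^ n) by (apply pow_lt; lra).
    rewrite pow_inv, <- Rinv_mult.
    apply Rle_div_l; [nra |].
    replace (/ (INR (fact n) * (nu + 1) ^ n)
             * (INR (fact n) * Gamma (nu + INR n + 1)))
      with (Gamma (nu + INR n + 1) / (nu + 1) ^ n) by (field; lra).
    apply Rle_div_r; lra.
Qed.

(** The upper bound is the n-th term of the exponential series at x^2 / (4 (nu + 1)). *)
Lemma besselI_term_bounds (nu x : R) (n : nat) :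
  -1 < nu ->
  0 <= Gamma (nu + 1) / (INR (fact n) * Gamma (nu + INR n + 1))
         * (x / 2) ^ (2 * n)
    <= / INR (fact n) * (x ^ 2 / (4 * (nu + 1))) ^ n.
Proof.
  intros Hnu. destruct (besselI_coeff_bounds nu n Hnu) as [H1 H2].
  rewrite pow_mult. assert (H3 : 0 <= (x / 2) ^ 2) by apply pow2_ge_0.
  assert (H4 : 0 <= ((x / 2) ^ 2) ^ n) by now apply pow_le.
  split; [nra |].
  replace (x ^ 2 / (4 * (nu + 1))) with (/ (nu + 1) * (x / 2) ^ 2) by (field; lra).
  rewrite Rpow_mult_distr, <- Rmult_assoc.
  now apply Rmult_le_compat_r.
Qed.

Lemma is_series_exp (x : R) : is_series (fun n => / INR (fact n) * x ^ n) (exp x).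
Proof.
  apply (is_series_ext
    (fun n => scal (pow_n x n) (/ INR (Factorial.fact n)))).
  - intros n. rewrite pow_n_pow. apply Rmult_comm.
  - exact (is_exp_Reals x).
Qed.

Lemma besselI_le_exp (nu x : R) :
  -1 < nu -> normalized_besselI nu x <= exp (x ^ 2 / (4 * (nu + 1))).
Proof.
  intros Hnu. rewrite <- (is_series_unique _ _ (is_series_exp _)).
  apply Series_le.
  - intros n. now apply besselI_term_bounds.
  - eexists. apply is_series_exp.
Qed.

Lemma besselI_ge (nu x : R) :
  -1 < nu -> 1 + x ^ 2 / (4 * (nu + 1)) <= normalized_besselI nu x.
Proof.
  intros Hnu. unfold normalized_besselI.
  set (c := fun n : nat => _).
  assert (Hc : forall n, 0 <= c n <= / INR (fact n) * (x ^ 2 / (4 * (nu + 1))) ^ n)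
    by (intros n; now apply besselI_term_bounds).
  (* [Series] is total, so splitting off its first terms requires convergence. *)
  assert (Hex : ex_series c).
  { apply (ex_series_le (V := R_CompleteNormedModule) c
      (fun n => / INR (fact n) * (x ^ 2 / (4 * (nu + 1))) ^ n)).
    - intros n. change (Rabs (c n) <= / INR (fact n) * (x ^ 2 / (4 * (nu + 1))) ^ n).
      rewrite Rabs_pos_eq; apply Hc.
    - eexists. apply is_series_exp. }
  rewrite (Series_incr_n c 2) by (trivial; auto).
  assert (Ht : 0 <= Series (fun k => c (2 + k)%nat)).
  (* Zero is rewritten as the sum of a zero series, to be compared termwise with the tail. *)
  { rewrite <- (Rmult_0_l (Series (fun _ => 0))), <- Series_scal_l.
    apply Series_le.
    - intros n. rewrite Rmult_0_l. split; [lra | apply Hc].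
    - now apply ex_series_incr_n. }
  assert (HG : 0 < Gamma (nu + 1)) by (apply Gamma_correct; lra).
  assert (H0 : c 0%nat = 1)
    by (unfold c; simpl; rewrite Rplus_0_r; field; lra).
  assert (H1 : c 1%nat = x ^ 2 / (4 * (nu + 1)))
    by (unfold c; simpl; rewrite (Gamma_succ (nu + 1)) by lra; field; lra).
  simpl. simpl in Ht. lra.
Qed.

(** * The variable u = x^2 / r^2 and the sharp exponents *)

Lemma sqr_ratio_bounds (r x : R) :
  0 < r -> Rabs x < r -> 0 <= x ^ 2 / r ^ 2 < 1.
Proof.
  intros Hr Hx. apply Rabs_def2 in Hx. split.
  - apply Rdiv_le_0_compat; nra.
  - apply Rlt_div_l; nra.
Qed.

(** For sharpness: a bound assumed for all |x| < r becomes one for every u in [0, 1). *)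
Lemma sqr_ratio_onto (r u : R) :
  0 < r -> 0 <= u < 1 -> exists x, Rabs x < r /\ x ^ 2 = u * r ^ 2.
Proof.
  intros Hr Hu. exists (r * sqrt u). split.
  - assert (sqrt u < 1) by (rewrite <- sqrt_1; apply sqrt_lt_1; lra).
    pose proof (sqrt_pos u). rewrite Rabs_pos_eq; nra.
  - rewrite Rpow_mult_distr, pow2_sqrt by lra. ring.
Qed.

Lemma exponent_nonneg (a rho : R) :
  0 <= a ->
  (forall u, 0 <= u < 1 -> Rpower (1 - u) rho <= exp (a * u)) -> 0 <= rho.
Proof.
  intros Ha H. apply Rnot_lt_le. intros Hrho.
  (* At 1 - u = exp (-t) the left side equals exp (a + 1), whereas the right side is at most exp
     a. *)
  set (t := (a + 1) / - rho).
  assert (Ht : 0 < t) by (apply Rdiv_lt_0_compat; lra).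
  assert (He : exp (- t) < 1) by (rewrite <- exp_0; apply exp_increasing; lra).
  pose proof (exp_pos (- t)).
  specialize (H (1 - exp (- t)) ltac:(lra)).
  replace (1 - (1 - exp (- t))) with (exp (- t)) in H by ring.
  unfold Rpower in H. rewrite ln_exp in H.
  replace (rho * - t) with (a + 1) in H by (unfold t; field; lra).
  assert (exp (a * (1 - exp (- t))) < exp (a + 1))
    by (apply exp_increasing; nra).
  lra.
Qed.

(** Both sides equal 1 at u = 0, so their slopes there must satisfy a <= -b. Instead of a limit, an
    explicit small u gives the contradiction. *)
Lemma exponent_le (a b : R) :
  0 < a ->
  (forall u, 0 <= u < 1 -> 1 + a * u <= Rpower (1 - u) b) -> b <= - a.
Proof.
  intros Ha H.
  (* [ln y >= 1 - / y] on the left and on the right turns the hypothesis into a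
     rational inequality. *)
  assert (Hln : forall y, 0 < y -> 1 - / y <= ln y).
  { intros y Hy. pose proof (ln_le_sub_1 (/ y) (Rinv_0_lt_compat y Hy)) as Hl.
    rewrite ln_Rinv in Hl; lra. }
  assert (Hu : forall u, 0 < u < 1 -> a / (1 + a * u) <= - b / (1 - u)).
  { intros u Hu. specialize (H u ltac:(lra)).
    assert (Hau : 0 < a * u) by nra.
    pose proof (Hln (1 + a * u) ltac:(lra)) as H1.
    pose proof (Hln (1 - u) ltac:(lra)) as H2.
    assert (H3 : ln (1 + a * u) <= b * ln (1 - u)).
    { rewrite <- (ln_exp (b * ln (1 - u))). apply ln_le; [lra | exact H]. }
    pose proof (ln_le_sub_1 (1 - u) ltac:(lra)) as H4.
    assert (H5 : 0 < 1 - / (1 + a * u)).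
    { replace (1 - / (1 + a * u)) with (a * u / (1 + a * u)) by (field; lra).
      apply Rdiv_lt_0_compat; lra. }
    (* Here b ln (1 - u) is positive and ln (1 - u) negative. The sign of b then turns the lower
       bound on ln (1 - u) into an upper bound on b ln (1 - u). *)
    assert (Hb : b < 0) by nra.
    assert (H6 : 1 - / (1 + a * u) <= b * (1 - / (1 - u))) by nra.
    apply Rmult_le_reg_r with u; [lra |].
    replace (a / (1 + a * u) * u) with (1 - / (1 + a * u)) by (field; lra).
    replace (- b / (1 - u) * u) with (b * (1 - / (1 - u))) by (field; lra).
    exact H6. }
  apply Rnot_lt_le. intros Hlt.
  assert (Hb : b < 0).
  { specialize (Hu (1 / 2) ltac:(lra)).
    assert (0 < a / (1 + a * (1 / 2))) by (apply Rdiv_lt_0_compat; nra).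
    lra. }
  (* The midpoint between 0 and the value of u at which [a (1 - u)] and
     [- b (1 + a u)] agree. *)
  set (u := (a + b) / (2 * a * (1 - b))).
  assert (Hden : 0 < 2 * a * (1 - b)) by nra.
  assert (H0u : 0 < u) by (apply Rdiv_lt_0_compat; lra).
  assert (Hu1 : u < 1) by (apply Rlt_div_l; nra).
  assert (E : u * (2 * a * (1 - b)) = a + b) by (unfold u; field; lra).
  clearbody u. specialize (Hu u (conj H0u Hu1)).
  assert (Hau : 0 < a * u) by now apply Rmult_lt_0_compat.
  apply (Rmult_le_compat_r ((1 + a * u) * (1 - u))) in Hu; [| nra].
  replace (a / (1 + a * u) * ((1 + a * u) * (1 - u))) with (a * (1 - u)) in Hu
    by (field; lra).
  replace (- b / (1 - u) * ((1 + a * u) * (1 - u))) with (- b * (1 + a * u)) in Hu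
    by (field; lra).
  (* The inequality rearranges to a + b <= u a (1 - b), which equals (a + b) / 2, against a + b >
     0. *)
  nra.
Qed.

Theorem theorem4 :
  forall (nu r : R), -1 < nu -> 0 < r ->
  let rho_nu := 0 in
  let varrho_nu := - (r ^ 2 / (4 * (nu + 1))) in
  (forall x : R, Rabs x < r ->
     Rpower ((r ^ 2 - x ^ 2) / r ^ 2) rho_nu <= normalized_besselI nu x
     /\ normalized_besselI nu x <= Rpower ((r ^ 2 - x ^ 2) / r ^ 2) varrho_nu)
  /\ is_least
       (fun rho : R => forall x : R, Rabs x < r ->
          Rpower ((r ^ 2 - x ^ 2) / r ^ 2) rho <= normalized_besselI nu x)
       rho_nu
  /\ is_greatest
       (fun varrho : R => forall x : R, Rabs x < r ->
          normalized_besselI nu x <= Rpower ((r ^ 2 - x ^ 2) / r ^ 2) varrho)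
       varrho_nu.
Proof.
  intros nu r Hnu Hr rho_nu varrho_nu.
  assert (Ha : 0 < r ^ 2 / (4 * (nu + 1))) by (apply Rdiv_lt_0_compat; nra).
  assert (HL : forall x : R, Rabs x < r ->
    Rpower ((r ^ 2 - x ^ 2) / r ^ 2) rho_nu <= normalized_besselI nu x).
  { intros x Hx. unfold Rpower, rho_nu. rewrite Rmult_0_l, exp_0.
    pose proof (besselI_ge nu x Hnu).
    assert (0 <= x ^ 2 / (4 * (nu + 1)))
      by (apply Rdiv_le_0_compat; [apply pow2_ge_0 | lra]).
    lra. }
  assert (HU : forall x : R, Rabs x < r ->
    normalized_besselI nu x <= Rpower ((r ^ 2 - x ^ 2) / r ^ 2) varrho_nu).
  { intros x Hx. pose proof (sqr_ratio_bounds r x Hr Hx) as Hu.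
    apply Rle_trans with (1 := besselI_le_exp nu x Hnu).
    unfold Rpower, varrho_nu. apply exp_monotone.
    replace ((r ^ 2 - x ^ 2) / r ^ 2) with (1 - x ^ 2 / r ^ 2) by (field; lra).
    pose proof (ln_le_sub_1 (1 - x ^ 2 / r ^ 2) ltac:(lra)).
    replace (x ^ 2 / (4 * (nu + 1)))
      with (r ^ 2 / (4 * (nu + 1)) * (x ^ 2 / r ^ 2)) by (field; lra).
    nra. }
  (* [HL] and [HU] also show that both constants are admissible; only their optimality remains
     besides the bounds. *)
  split; [| split; split; trivial].
  - intros x Hx. split; [now apply HL | now apply HU].
  - intros rho H. apply (exponent_nonneg (r ^ 2 / (4 * (nu + 1)))); [lra |].
    intros u Hu. destruct (sqr_ratio_onto r u Hr Hu) as (x & Hx & Ex).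
    specialize (H x Hx). pose proof (besselI_le_exp nu x Hnu) as H1.
    rewrite Ex in H, H1.
    replace ((r ^ 2 - u * r ^ 2) / r ^ 2) with (1 - u) in H by (field; lra).
    replace (u * r ^ 2 / (4 * (nu + 1))) with (r ^ 2 / (4 * (nu + 1)) * u) in H1
      by (field; lra).
    lra.
  - intros varrho H. apply exponent_le; [exact Ha |].
    intros u Hu. destruct (sqr_ratio_onto r u Hr Hu) as (x & Hx & Ex).
    specialize (H x Hx). pose proof (besselI_ge nu x Hnu) as H1.
    rewrite Ex in H, H1.
    replace ((r ^ 2 - u * r ^ 2) / r ^ 2) with (1 - u) in H by (field; lra).
    replace (u * r ^ 2 / (4 * (nu + 1))) with (r ^ 2 / (4 * (nu + 1)) * u) in H1
      by (field; lra).
    lra.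
Qed.
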